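(* Let $(X,f,x_0)$ be a counting system and let $\#$ be the unique iterator for $(X,f,x_0)$. If $(X,f,x_0)$ is standard then the iterator $\#$ is complete, i.e. $B \approx A$ whenever $A$ and $B$ are finite sets with $\#(B) = \#(A)$.
   Context: For a set $A$ let $\mathcal{P}(A)$ denote its power set. A subset $\mathcal{K} \subset \mathcal{P}(A)$ is an inductive system in $\mathcal{P}(A)$ if $\varnothing \in \mathcal{K}$ and $B \cup \{a\} \in \mathcal{K}$ for all $B \in \mathcal{K}$ and $a \in A \setminus B$. A set $A$ is finite if $\mathcal{P}(A)$ itself is the only inductive system in $\mathcal{P}(A)$. Write $A \approx B$ if there exists a bijective mapping $h : A \to B$. A counting system is a triple $(X,f,x_0)$ with $X$ a set, $f : X \to X$ a mapping and $x_0 \in X$. It is standard if $f$ is injective and $f(x) \ne x_0$ for all $x \in X$. An iterator for $(X,f,x_0)$ is an assignment $A \mapsto \#(A)$ of an element of $X$ to each finite set $A$ such that $\#(\varnothing) = x_0$ and $\#(A \cup \{a\}) = f(\#(A))$ whenever $A$ is a finite set and $a \notin A$. Each counting system has a unique iterator. *)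

(* Defs.v *)
From mathcomp Require Import all_boot.
From mathcomp Require Import boolp classical_sets functions cardinality.

Set Implicit Arguments.
Unset Strict Implicit.
Unset Printing Implicit Defensive.

Local Open Scope classical_set_scope.

Definition power_set (U : Type) (A : set U) : set (set U) :=
  [set B | B `<=` A].

Definition inductive_system (U : Type) (A : set U) (K : set (set U)) : Prop :=
  [/\ K `<=` power_set A,
      K set0
    & forall B a, K B -> (A `\` B) a -> K (B `|` [set a])].

Definition ind_finite (U : Type) (A : set U) : Prop :=
  forall K : set (set U), inductive_system A K <-> K = power_set A.

Lemma inductive_system_power_set (U : Type) (A : set U) :
  inductive_system A (power_set A).
Proof.
split=> // B a BA [Aa _] x [/BA//|-> //].
Qed.

Lemma ind_finite0 (U : Type) : ind_finite (@set0 U).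
Proof.
move=> K; split=> [[KA K0 _]|->]; last exact: inductive_system_power_set.
apply/seteqP; split=> // B; rewrite /power_set /= => B0.
by have -> : B = set0 by apply/seteqP; split.
Qed.

Lemma ind_finiteU1 (U : Type) (A : set U) (a : U) :
  ind_finite A -> ind_finite (A `|` [set a]).
Proof.
move=> finA; have [Aa|nAa] := pselect (A a).
  by have -> : A `|` [set a] = A by apply/setUidPl => x ->.
move=> K; split=> [[KA K0 KS]|->]; last exact: inductive_system_power_set.
have K1 : K `&` power_set A = power_set A.
  apply/finA; split; first by move=> B [].
    by split=> // x [].
  move=> B b [KB BA] [Ab nBb]; split; last by move=> x [/BA|->].
  by apply: KS => //; split=> //; left.
have K2 : [set B | B `<=` A /\ K (B `|` [set a])] = power_set A.
  apply/finA; split; first by move=> B [].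
    by split=> [x []//|]; apply: KS => //; split=> //; right.
  move=> B b [BA KB] [Ab nBb]; split; first by move=> x [/BA|->].
  rewrite -setUA (setUC [set b]) setUA; apply: KS => //.
  by split; [left|move=> [//|ba]; apply: nAa; rewrite -ba].
apply/seteqP; split=> // B BAa.
have [Ba|nBa] := pselect (B a).
  have BA : power_set A (B `\ a).
    by move=> x [Bx xa]; case: (BAa x Bx).
  move: BA; rewrite -K2 => -[_]; congr (K _).
  apply/seteqP; split=> [x [[]//|-> //]|x Bx].
  by have [->|xa] := pselect (x = a); [right|left].
have BA : power_set A B.
  by move=> x Bx; case: (BAa x Bx) => // xa; case: nBa; rewrite -xa.
by move: BA; rewrite -K1 => -[].
Qed.

Record finiteSet (U : Type) := FiniteSet {
  finiteSet_set :> set U;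
  finiteSet_finite : ind_finite finiteSet_set }.

Definition fempty (U : Type) : finiteSet U := FiniteSet (@ind_finite0 U).

Definition fadd (U : Type) (A : finiteSet U) (a : U) : finiteSet U :=
  FiniteSet (ind_finiteU1 a (finiteSet_finite A)).

Record countingSystem := CountingSystem {
  carrier :> Type;
  next : carrier -> carrier;
  start : carrier }.

Definition standard (X : countingSystem) : Prop :=
  injective (@next X) /\ forall x : X, next x <> start X.

(* The finite sets of the theory are the finite subsets of all types, so an
   assignment on finite sets is a family indexed by the ambient type. *)
Definition assignment (X : countingSystem) : Type :=
  forall U : Type, finiteSet U -> X.

Definition iterator (X : countingSystem) (num : assignment X) : Prop :=
  forall U : Type,
    num U (fempty U) = start X /\
    forall (A : finiteSet U) (a : U), ~ (A : set U) a ->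
      num U (fadd A a) = next (num U A).

(* A and B need not live in the same ambient type. *)
Definition complete (X : countingSystem) (num : assignment X) : Prop :=
  forall (U V : Type) (A : finiteSet U) (B : finiteSet V),
    num V B = num U A -> (B #= A)%card.

(* Main.v *)
(* Induction on A, for all B at once: a standard system separates the value
   [start] of the empty set from the values [next _] of the sets [A' + a], and
   injectivity of [next] lets one remove a point from A and B simultaneously. *)
Require Import Defs.
From mathcomp Require Import all_boot.
From mathcomp Require Import boolp classical_sets functions cardinality.

Set Implicit Arguments.
Unset Strict Implicit.
Unset Printing Implicit Defensive.

Local Open Scope classical_set_scope.

Lemma card_eqU1 (U V : Type) (A : set U) (B : set V) (a : U) (b : V) :
  ~ A a -> ~ B b -> (A #= B)%card ->
  (A `|` [set a] #= B `|` [set b])%card.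
Proof.
have disj1 (T : Type) (C : set T) (c : T) :
  ~ C c -> [disjoint C & [set c]]%classic.
  by move=> nCc; apply/disj_setPS => x [Cx xc]; apply: nCc; rewrite -xc.
move=> nAa nBb /card_eqP[f].
have /card_eqP[g] := eq_card1 a b.
(* [f] and [g] are bijections between subtypes; [valLR b] makes them total, with [b] as the default
   value, so that they can be glued along the disjoint unions. *)
exact: (pcard_eq (glue (disj1 _ _ _ nAa) (disj1 _ _ _ nBb) (valLR b f) (valLR b g))).
Qed.

Lemma finiteSet_ind (U : Type) (P : finiteSet U -> Prop) :
  P (fempty U) ->
  (forall (A : finiteSet U) (a : U), ~ (A : set U) a -> P A -> P (fadd A a)) ->
  forall A : finiteSet U, P A.
Proof.
move=> P0 PS [A finA].
(* [P] only speaks about sets with a finiteness proof, so [K] must carry one. *)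
pose K := [set B | B `<=` A /\ exists finB : ind_finite B, P (FiniteSet finB)].
have sysK : inductive_system A K.
  split; first by move=> B [].
    by split=> //; exists (@ind_finite0 U).
  move=> B a [BA [finB PB]] [Aa nBa]; split; first by move=> x [/BA|->].
  by exists (ind_finiteU1 a finB); apply: PS PB.
have : K A by rewrite (proj1 (finA K) sysK).
(* Membership in [K] gives [P] for some finiteness proof of [A], perhaps not the given one. *)
by move=> [_ [finA' PA]]; rewrite (Prop_irrelevance finA finA').
Qed.

(** Serves to take [B] apart within the induction on [A]. *)
Lemma finiteSet_case (U : Type) (A : finiteSet U) :
  A = fempty U \/
  exists (A' : finiteSet U) (a : U), ~ (A' : set U) a /\ A = fadd A' a.
Proof.
elim/finiteSet_ind: A => [|A a nAa _]; first by left.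
by right; exists A, a.
Qed.

Theorem theorem3p2 (X : countingSystem) (num : assignment X)
    (num_iterator : iterator num) :
  standard X -> complete num.
Proof.
move=> [next_inj next_start] U V A.
have [numU0 numUS] := num_iterator U.
have [numV0 numVS] := num_iterator V.
elim/finiteSet_ind: A => [|A a nAa IH] B.
  rewrite numU0; case: (finiteSet_case B) => [-> _|]; first exact: card_eq00.
  by move=> [B' [b [nBb ->]]]; rewrite numVS // => /next_start.
rewrite (numUS _ _ nAa); case: (finiteSet_case B) => [->|].
  by rewrite numV0 => /esym/next_start.
move=> [B' [b [nBb ->]]]; rewrite numVS // => /next_inj/IH.
exact: card_eqU1.
Qed.
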